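(* Consider a network with $n$ buses represented by its bus admittance matrix $\mathbf{Y}$, with voltage bounds $\underline{V}_i\le\overline{V}_i$ at each bus $i$. Let $$\mathcal{P}=\{\mathbf{p}\in\mathbb{R}^n : \exists\,\mathbf{v}=(V_1,\dots,V_n)\in\mathbb{C}^n,\ \mathbf{p}=\operatorname{Re}(\operatorname{diag}(\mathbf{v}\mathbf{v}^H\mathbf{Y}^H)),\ \underline{V}_i\le|V_i|\le\overline{V}_i\ \forall i\},$$ $$\tilde{\mathcal{P}}=\{\mathbf{p}\in\mathbb{R}^n : \exists\,\mathbf{W}\in\mathbb{C}^{n\times n}\text{ Hermitian},\ \mathbf{p}=\operatorname{Re}(\operatorname{diag}(\mathbf{W}\mathbf{Y}^H)),\ \underline{V}_i^2\le W_{ii}\le\overline{V}_i^2\ \forall i,\ \mathbf{W}\succeq 0\}.$$ If the network is a lossless cycle or a lossless cycle with one chord, then $\operatorname{convhull}(\mathcal{P})=\tilde{\mathcal{P}}$.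
   Context: A network is a connected undirected simple graph on buses $1,\dots,n$; write $i\sim k$ if buses $i\neq k$ are joined by a line. Each line $i\sim k$ has admittance $y_{ik}=y_{ki}=g_{ik}+jb_{ik}$ ($j=\sqrt{-1}$) with $b_{ik}<0$ (lines are inductive), and each bus $i$ has a shunt admittance to ground $y_{ii}$. The bus admittance matrix $\mathbf{Y}$ is the symmetric matrix with $Y_{ii}=\sum_{l\sim i}y_{il}+y_{ii}$, $Y_{ik}=-y_{ik}$ if $i\sim k$, and $Y_{ik}=0$ if $i\neq k$, $i\nsim k$. The network is lossless if all entries of $\mathbf{Y}$ are purely imaginary (so $g_{ik}=0$). A lossless cycle is a lossless network whose graph is a cycle on all $n$ buses; a lossless cycle with one chord is a lossless network whose graph is such a cycle together with one additional edge joining two non-adjacent vertices of the cycle. The voltage bounds satisfy $0\le\underline{V}_i\le\overline{V}_i<\infty$. $(\cdot)^H$ is the conjugate transpose, $\operatorname{diag}(\mathbf{M})$ is the vector of diagonal entries of $\mathbf{M}$, $\mathbf{W}\succeq0$ means positive semidefinite, and $\operatorname{convhull}$ is the convex hull. *)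

(* Defs.v *)
From mathcomp Require Import all_boot all_order all_algebra.
From mathcomp Require Import boolp classical_sets reals convex.
From mathcomp Require Import complex.

Set Implicit Arguments.
Unset Strict Implicit.
Unset Printing Implicit Defensive.

Import Order.TTheory GRing.Theory Num.Theory.

Local Open Scope classical_set_scope.
Local Open Scope ring_scope.
Local Open Scope sesquilinear_scope.

(* The buses 1, ..., n are indexed by 'I_n. [admittance i k] is only
   meaningful when [line i k] holds. *)
Record network (R : realType) (n : nat) := Network {
  line : rel 'I_n;
  line_sym : symmetric line;
  line_irr : irreflexive line;
  line_connected : forall i k, connect line i k;
  admittance : 'I_n -> 'I_n -> R[i];
  admittance_sym : forall i k, line i k -> admittance i k = admittance k i;
  line_inductive : forall i k, line i k -> complex.Im (admittance i k) < 0;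
  shunt : 'I_n -> R[i]
}.

Definition bus_admittance (R : realType) (n : nat) (N : network R n) :
    'M[R[i]]_n :=
  \matrix_(i, k)
    if i == k then \sum_(l | line N l i) admittance N i l + shunt N i
    else if line N i k then - admittance N i k
    else 0.

Definition lossless (R : realType) (n : nat) (N : network R n) : Prop :=
  forall i k, complex.Re (bus_admittance N i k) = 0.

(* [s] lists every bus exactly once; with n >= 3 it is the cyclic order of the
   vertices along a simple cycle through all buses. *)
Definition cyclic_order (n : nat) (s : seq 'I_n) : Prop :=
  [/\ (2 < n)%N, uniq s & forall i, i \in s].

Definition cycle_edge (n : nat) (s : seq 'I_n) : rel 'I_n :=
  fun i k => (next s i == k) || (next s k == i).

Definition is_cycle (n : nat) (e : rel 'I_n) : Prop :=
  exists2 s, cyclic_order s & forall i k, e i k = cycle_edge s i k.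

Definition is_cycle_with_chord (n : nat) (e : rel 'I_n) : Prop :=
  exists s a b,
    [/\ cyclic_order s, a != b, ~~ cycle_edge s a b
      & forall i k, e i k =
          [|| cycle_edge s i k, (i == a) && (k == b) | (i == b) && (k == a)]].

Definition lossless_cycle (R : realType) (n : nat) (N : network R n) : Prop :=
  lossless N /\ is_cycle (line N).

Definition lossless_cycle_with_chord (R : realType) (n : nat)
    (N : network R n) : Prop :=
  lossless N /\ is_cycle_with_chord (line N).

Definition convhull (R : realType) (E : lmodType R) (A : set E) : set E :=
  smallest (@convex_set R E) A.

Definition re_diag (R : realType) (n : nat) (M : 'M[R[i]]_n) : 'cV[R]_n :=
  \col_i complex.Re (M i i).

(* In R[i], [0 <= z] means that z is a nonnegative real number. *)
Definition possemidef (R : realType) (n : nat) (W : 'M[R[i]]_n) : Prop :=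
  W \is hermsymmx /\ forall x : 'cV[R[i]]_n, 0 <= (x ^t* *m W *m x) 0 0.

Definition injection_region (R : realType) (n : nat) (Y : 'M[R[i]]_n)
    (Vmin Vmax : 'I_n -> R) : set 'cV[R]_n :=
  [set p | exists v : 'cV[R[i]]_n,
     p = re_diag (v *m v ^t* *m Y ^t*) /\
     forall i, (Vmin i)%:C%C <= `|v i 0| <= (Vmax i)%:C%C].

Definition relaxed_injection_region (R : realType) (n : nat) (Y : 'M[R[i]]_n)
    (Vmin Vmax : 'I_n -> R) : set 'cV[R]_n :=
  [set p | exists W : 'M[R[i]]_n,
     [/\ W \is hermsymmx,
         p = re_diag (W *m Y ^t*),
         forall i, (Vmin i ^+ 2)%:C%C <= W i i <= (Vmax i ^+ 2)%:C%C
       & possemidef W]].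

(* Main.v *)
Require Import Defs.
From mathcomp Require Import all_boot all_order all_algebra.
From mathcomp Require Import boolp classical_sets reals.
From mathcomp Require Import complex convex interval_inference trigo ring lra.

(* In a lossless network the injections are a linear function of the numbers
   Im (W i k) on the lines.  Hence a feasible W has its injection vector in the
   convex hull as soon as, for every choice of a sign on each line, some
   voltage vector v with |v i| ^+ 2 = W i i has Im (v i * (v k)^* ) above or
   below Im (W i k) on every line, as prescribed by the sign.
   After normalising the diagonal of W to 1, such a v is found as follows.
   Reading Im as Re (z * _) with z a quarter turn, the entries of W are cosines
   of angles between unit vectors.  By the triangle inequality for angles, the
   vertices along a path can be given phases one after the other, no phase step
   exceeding the corresponding angle, whenever this holds for the total step
   from one end a to the other end b.  A cycle is two paths from a to b, and a
   chord is a third one.  Each of them prescribes a lower bound on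
   Re (z * (v a * (v b)^* )) for one quarter turn z; at most three of the four
   quarter turns occur, and these three bounds can be met together. *)

Set Implicit Arguments.
Unset Strict Implicit.
Unset Printing Implicit Defensive.
Import Order.TTheory GRing.Theory Num.Theory.
Local Open Scope classical_set_scope.
Local Open Scope ring_scope.
Local Open Scope sesquilinear_scope.
Local Notation Re := (@complex.Re _).
Local Notation Im := (@complex.Im _).

(** * Splitting a plane angle in two *)

(* With c1 = cos A and c2 = cos B, the last hypothesis says cos (A + B) <= p. *)
Lemma planar_split (R : realType) (c1 c2 p q : R) :
    -1 <= c1 <= 1 -> -1 <= c2 <= 1 -> p ^+ 2 + q ^+ 2 = 1 ->
    c1 * c2 - Num.sqrt (1 - c1 ^+ 2) * Num.sqrt (1 - c2 ^+ 2) <= p ->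
  exists x y, [/\ x ^+ 2 + y ^+ 2 = 1, c1 <= x & c2 <= p * x + q * y].
Proof.
move=> b1 b2 pq hp.
wlog q0 : q pq / 0 <= q.
  move=> H; have [/H|/ltW q0] := leP 0 q; first exact.
  have [] := H (- q); rewrite ?sqrrN ?oppr_ge0 // => x [y [xy h1 h2]].
  by exists x, (- y); rewrite sqrrN mulrN -mulNr.
(* Let w be the angle of (p, q). If w <= A, the first part takes all of it. Otherwise turn by
   exactly A: the rest w - A is at most B, since either w <= A + B or w <= pi < A + B. *)
have [h|h] := leP c1 p.
  by exists p, q; split=> //; rewrite -!expr2 pq; case/andP: b2.
have bp : -1 <= p <= 1 by apply/andP; split; nra.
set w := acos p; set a := acos c1; set b := acos c2.
have [w0 a0 b0] : [/\ 0 <= w, 0 <= a & 0 <= b] by rewrite !acos_ge0.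
have [w1 a1 b1'] : [/\ w <= pi, a <= pi & b <= pi] by rewrite !acos_lepi.
have cw : cos w = p by rewrite acosK ?in_itv.
have ca : cos a = c1 by rewrite acosK ?in_itv.
have cb : cos b = c2 by rewrite acosK ?in_itv.
have sw : sin w = q.
  by rewrite sin_acos // -pq [_ + q ^+ 2]addrC addrK sqrtr_sqr ger0_norm.
have aw : a <= w.
  by rewrite leNgt -ltr_cos ?in_itv /= ?w0 ?a0 ?w1 // ca cw -leNgt ltW.
exists (cos a), (sin a); split; first exact: cos2Dsin2.
  by rewrite ca.
rewrite -cw -sw -cosB -cb leNgt.
rewrite ltr_cos ?in_itv /= ?b0 ?subr_ge0 ?aw //; last first.
  by apply: le_trans w1; rewrite gerBl.
rewrite -leNgt lerBlDl.
have [ab|/ltW ab] := leP (a + b) pi; last exact: le_trans ab.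
rewrite leNgt -ltr_cos ?in_itv /= ?w0 ?w1 ?addr_ge0 //.
by rewrite cosD ca cb cw !sin_acos // -leNgt.
Qed.

(** * Positive semidefinite matrices tested on three coordinates *)

Lemma hermsymmx_entry (R : realType) (n : nat) (W : 'M[R[i]]_n) i k :
  W \is hermsymmx -> W k i = (W i k)^*%C.
Proof. by move/is_hermitianmxP => {1}->; rewrite scale1r !mxE. Qed.

(** Bilinear expansion at a sum of three scaled basis vectors; the indices may therefore coincide,
    as they do in later uses. *)
Lemma possemidef_quad3 (R : realType) (n : nat) (W : 'M[R[i]]_n) i j l
    (a b c : R[i]) : possemidef W ->
  0 <= a^*%C * a * W i i + b^*%C * b * W j j + c^*%C * c * W l l
     + (a^*%C * b * W i j + b^*%C * a * W j i)
     + (a^*%C * c * W i l + c^*%C * a * W l i)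
     + (b^*%C * c * W j l + c^*%C * b * W l j).
Proof.
pose col (p : 'I_n) (t : R[i]) : 'cV[R[i]]_n := t *: delta_mx p 0.
pose row (p : 'I_n) (t : R[i]) : 'rV[R[i]]_n := t *: delta_mx 0 p.
pose form (v : 'rV[R[i]]_n) (w : 'cV[R[i]]_n) : R[i] := (v *m W *m w) 0 0.
have E p q s t : form (row p s) (col q t) = s * t * W p q.
  rewrite /form /row /col -!scalemxAl -scalemxAr.
  have -> : delta_mx 0 p *m W = matrix.row p W by exact/esym/rowE.
  have -> : matrix.row p W *m delta_mx q 0 = matrix.col q (matrix.row p W).
    exact/esym/colE.
  by rewrite !mxE mulrA.
have formDl v w t : form (v + w) t = form v t + form w t.
  by rewrite /form !mulmxDl mxE.
have formDr v t w : form v (t + w) = form v t + form v w.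
  by rewrite /form mulmxDr mxE.
have conj_col :
    (col i a + col j b + col l c) ^t* = row i a^*%C + row j b^*%C + row l c^*%C.
  apply/matrixP => u v; rewrite !mxE !rmorphD !rmorphM !rmorph_nat /=.
  by rewrite ![(v == _) && _]andbC.
case=> _ /(_ (col i a + col j b + col l c)); rewrite conj_col -/(form _ _).
clearbody form col row; rewrite !formDl !formDr !E.
by congr (_ <= _); ring.
Qed.

Definition unimodular (R : realType) (z : R[i]) := z^*%C * z = 1.

(* The off-diagonal part u of a positive semidefinite matrix whose diagonal
   entries are at most 1, tested on vectors with at most three nonzero
   coordinates. *)
Definition subunit_gram (R : realType) (n : nat) (u : 'I_n -> 'I_n -> R[i]) :=
  forall i j l (a b c : R[i]),
    0 <= Re (a^*%C * a) + Re (b^*%C * b) + Re (c^*%C * c)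
       + 2 * Re (a^*%C * b * u i j) + 2 * Re (a^*%C * c * u i l)
       + 2 * Re (b^*%C * c * u j l).

Lemma Re_realM (R : realType) (x : R) (z : R[i]) : Re (x%:C%C * z) = x * Re z.
Proof. by case: z => a b; simpc. Qed.

Lemma ReD (R : realType) (y z : R[i]) : Re (y + z) = Re y + Re z.
Proof. by case: y z => ? ? []. Qed.

Lemma conjc_realM (R : realType) (x : R) (z : R[i]) :
  (x%:C%C * z)^*%C = (x%:C%C * z^*%C).
Proof. by case: z => a b; simpc. Qed.

Lemma Im_realM (R : realType) (x : R) (z : R[i]) : Im (x%:C%C * z) = x * Im z.
Proof. by case: z => a b; simpc. Qed.

Lemma unimodular1 (R : realType) : unimodular (1 : R[i]).
Proof. by rewrite /unimodular conjc1 mulr1. Qed.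

Lemma unimodularM (R : realType) (y z : R[i]) :
  unimodular y -> unimodular z -> unimodular (y * z).
Proof. by rewrite /unimodular rmorphM mulrACA => -> ->; rewrite mulr1. Qed.

Lemma unimodularJ (R : realType) (z : R[i]) :
  unimodular z -> unimodular z^*%C.
Proof. by rewrite /unimodular conjcK mulrC. Qed.

Lemma unimodularP (R : realType) (x y : R) :
  unimodular (x +i* y)%C <-> x ^+ 2 + y ^+ 2 = 1.
Proof.
rewrite /unimodular.
have -> : (x +i* y)%C^*%C * (x +i* y)%C = (x ^+ 2 + y ^+ 2)%:C%C.
  by apply/eqP; rewrite eq_complex /=; apply/andP; split; apply/eqP; ring.
by split=> [/complexI|->].
Qed.

(* 0^-1 = 0, so buses with W i i = 0 get a zero row. *)
Lemma normalized_gram (R : realType) (n : nat) (W : 'M[R[i]]_n) :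
    possemidef W ->
  subunit_gram (fun i k => W i k *
    ((Num.sqrt (Re (W i i)))^-1 * (Num.sqrt (Re (W k k)))^-1)%:C%C).
Proof.
move=> psdW i j l a b c; set r := fun i => (Num.sqrt (Re (W i i)))^-1.
have diag (z : R[i]) k :
    Re ((z * (r k)%:C%C)^*%C * (z * (r k)%:C%C) * W k k) <= Re (z^*%C * z).
  have -> : (z * (r k)%:C%C)^*%C * (z * (r k)%:C%C)
      = (r k ^+ 2)%:C%C * (z^*%C * z).
    by rewrite ![z * _]mulrC conjc_realM rmorphXn /=; ring.
  rewrite -mulrA Re_realM.
  case: z => x y; case E: (W k k) => [d e]; simpc => /=.
  rewrite [y * x]mulrC subrr mul0r subr0 mulrCA -[leRHS]mulr1; apply: ler_wpM2l.
    by rewrite -!expr2 addr_ge0 ?sqr_ge0.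
  rewrite /r E /= exprVn; have [d0|d0] := leP d 0.
    by rewrite ler0_sqrtr // expr0n invr0 mul0r.
  by rewrite sqr_sqrtr ?mulVf ?gt_eqF // ltW.
have herm p q (y z : R[i]) :
    Re ((y * (r p)%:C%C)^*%C * (z * (r q)%:C%C) * W p q
        + (z * (r q)%:C%C)^*%C * (y * (r p)%:C%C) * W q p) =
    2 * Re (y^*%C * z * (W p q * (r p * r q)%:C%C)).
  rewrite (hermsymmx_entry p q psdW.1).
  by case: y z (W p q) => [? ?] [? ?] [? ?]; simpc => /=; ring.
have := possemidef_quad3 i j l
  (a * (r i)%:C%C) (b * (r j)%:C%C) (c * (r l)%:C%C) psdW.
rewrite lecE => /andP[_] /=; rewrite ReD herm ReD herm ReD herm !ReD => H.
apply: le_trans H _; rewrite -!/(r _) !lerD2r.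
by apply: lerD; [apply: lerD|]; exact: diag.
Qed.

(** * Angles between Gram vectors and phases along a path *)

(** With c1 = cos A and c2 = cos B, this is the triangle inequality for angles. Eliminating the
    middle coordinate from the three-coordinate form (a Schur complement) leaves a nonnegative form
    in the outer two, which bounds how far [Re (z1 * z2 * u i l)] lies from [c1 * c2]. *)
Lemma gram_angle_triangle (R : realType) (n : nat) (u : 'I_n -> 'I_n -> R[i])
    i j l (z1 z2 : R[i]) :
    subunit_gram u -> unimodular z1 -> unimodular z2 ->
  let c1 := Re (z1 * u i j) in let c2 := Re (z2 * u j l) in
  [/\ -1 <= c1 <= 1, -1 <= c2 <= 1 &
      c1 * c2 - Num.sqrt (1 - c1 ^+ 2) * Num.sqrt (1 - c2 ^+ 2)
        <= Re (z1 * z2 * u i l)].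
Proof.
move=> gu u1 u2 c1 c2; set c := Re _.
have Q (s t : R) : 0 <= s ^+ 2 * (1 - c1 ^+ 2) + t ^+ 2 * (1 - c2 ^+ 2)
                       + 2 * (s * t * (c - c1 * c2)).
  (* The real [m] that minimises the form for given [s] and [t]. *)
  set m := - (s * c1 + t * c2).
  have := gu i j l s%:C%C (m%:C%C * z1) (t%:C%C * (z1 * z2)).
  have -> : s%:C%C^*%C * s%:C%C = (s ^+ 2)%:C%C * 1.
    by rewrite conjc_real mulr1 rmorphXn.
  have -> : (m%:C%C * z1)^*%C * (m%:C%C * z1) = (m ^+ 2)%:C%C * 1.
    by rewrite -u1 conjc_realM rmorphXn /=; ring.
  have -> : (t%:C%C * (z1 * z2))^*%C * (t%:C%C * (z1 * z2)) = (t ^+ 2)%:C%C * 1.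
    by rewrite -(unimodularM u1 u2) conjc_realM rmorphXn /=; ring.
  have -> : s%:C%C^*%C * (m%:C%C * z1) * u i j = (s * m)%:C%C * (z1 * u i j).
    by rewrite conjc_real rmorphM; ring.
  have -> : s%:C%C^*%C * (t%:C%C * (z1 * z2)) * u i l
      = (s * t)%:C%C * (z1 * z2 * u i l).
    by rewrite conjc_real rmorphM; ring.
  have -> : (m%:C%C * z1)^*%C * (t%:C%C * (z1 * z2)) * u j l
      = (m * t)%:C%C * (z2 * u j l).
    by rewrite -[z2 * u j l]mul1r -u1 conjc_realM rmorphM /=; ring.
  rewrite !Re_realM -/c1 -/c2 -/c /= /m => H; apply: le_trans H _.
  by rewrite le_eqVlt; apply/orP; left; apply/eqP; ring.
have d1 : 0 <= 1 - c1 ^+ 2 by have := Q 1 0; nra.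
have d2 : 0 <= 1 - c2 ^+ 2 by have := Q 0 1; nra.
split; [by apply/andP; split; nra | by apply/andP; split; nra |].
set s1 := Num.sqrt _; set s2 := Num.sqrt _.
have [s1E s2E] : s1 ^+ 2 = 1 - c1 ^+ 2 /\ s2 ^+ 2 = 1 - c2 ^+ 2.
  by rewrite !sqr_sqrtr.
have [s1_ge0 s2_ge0] : 0 <= s1 /\ 0 <= s2 by rewrite !sqrtr_ge0.
rewrite -s1E -s2E in Q.
rewrite lerBlDr -subr_ge0.
have [/andP[p1 p2]|] := boolP ((0 < s1) && (0 < s2)).
  (* These arguments balance the two square terms, so that 2 * s1 * s2 factors out and leaves the
     claim. *)
  have := Q s2 s1.
  have -> : s2 ^+ 2 * s1 ^+ 2 + s1 ^+ 2 * s2 ^+ 2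
      + 2 * (s2 * s1 * (c - c1 * c2))
    = (2 * (s1 * s2)) * (c + s1 * s2 - c1 * c2) by ring.
  by rewrite pmulr_rge0 // !mulr_gt0.
set d := c - c1 * c2 in Q.
rewrite negb_and -!leNgt => H.
(* A nonnegative form with a zero diagonal coefficient has no cross term: at the arguments used
   below it equals - d ^+ 2 times a positive number. *)
suff d0 : d = 0 by rewrite addrAC -/d d0 add0r mulr_ge0.
apply/eqP; rewrite -sqrf_eq0 eq_le sqr_ge0 andbT.
have [s0|s0] : s1 = 0 \/ s2 = 0.
- by case/orP: H => h; [left|right]; apply/eqP; rewrite eq_le h.
- by have := Q (s2 ^+ 2 + 1) (- d); rewrite s0; nra.
- by have := Q (- d) (s1 ^+ 2 + 1); rewrite s0; nra.
Qed.

(** The number [z1 * z2 * (x * y^*%C)] lies on the unit circle; [planar_split] divides its angle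
    between the steps from [i] to [j] and from [j] to [l]. *)
Lemma insert_phase (R : realType) (n : nat) (u : 'I_n -> 'I_n -> R[i]) i j l
    (z1 z2 x y : R[i]) :
    subunit_gram u -> unimodular z1 -> unimodular z2 ->
    unimodular x -> unimodular y ->
    Re (z1 * z2 * u i l) <= Re (z1 * z2 * (x * y^*%C)) ->
  exists t, [/\ unimodular t, Re (z1 * u i j) <= Re (z1 * (x * t^*%C))
              & Re (z2 * u j l) <= Re (z2 * (t * y^*%C))].
Proof.
move=> gu u1 u2 ux uy h.
have [b1 b2 hc] := gram_angle_triangle i j l gu u1 u2.
have {h hc} := le_trans hc h.
have : unimodular (z1 * z2 * (x * y^*%C)).
  by do ?apply: unimodularM => //; exact: unimodularJ.
case E : (z1 * z2 * (x * y^*%C)) => [p q] /unimodularP pq hp.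
have [s [t [/unimodularP st h1 h2]]] := planar_split b1 b2 pq hp.
have conjM (v w : R[i]) : (v * w)^*%C = v^*%C * w^*%C by rewrite rmorphM.
(* Chosen so that [z1 * x] times its conjugate is [s +i* t]. *)
exists (z1 * x * (s +i* t)%C^*%C); split.
- by do ?apply: unimodularM => //; exact: unimodularJ.
- rewrite !conjM conjcK.
  have -> : z1 * (x * (z1^*%C * x^*%C * (s +i* t)%C)) =
    (z1^*%C * z1) * (x^*%C * x) * (s +i* t)%C by ring.
  by rewrite u1 ux !mul1r.
- have -> : z2 * (z1 * x * (s +i* t)%C^*%C * y^*%C) =
    (z1 * z2 * (x * y^*%C)) * (s +i* t)%C^*%C by ring.
  by rewrite E; simpc => /=; rewrite ?opprK.
Qed.

Fixpoint path_phase (R : realType) (n : nat) (z : 'I_n -> 'I_n -> R[i])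
    (i : 'I_n) (s : seq 'I_n) : R[i] :=
  if s is k :: s' then z i k * path_phase z k s' else 1.

(** A [rel], so that [path] expresses domination along a path and [next_cycle] applies to cycles. *)
Definition dominates (R : realType) (n : nat) (z u : 'I_n -> 'I_n -> R[i])
    (e : 'I_n -> R[i]) : rel 'I_n :=
  fun i k => Re (z i k * u i k) <= Re (z i k * (e i * (e k)^*%C)).

Lemma path_phase_unimodular (R : realType) (n : nat)
    (z : 'I_n -> 'I_n -> R[i]) i s :
  (forall i k, unimodular (z i k)) -> unimodular (path_phase z i s).
Proof.
move=> uz; elim: s i => [|k s IH] i /=; first exact: unimodular1.
exact: unimodularM.
Qed.

(** Induction along the path with both end phases fixed. [insert_phase] treats the tail as one edge
    with multiplier its [path_phase]; the second bound it returns is the hypothesis needed for the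
    tail. *)
Lemma path_dominates (R : realType) (n : nat) (z u : 'I_n -> 'I_n -> R[i])
    i s (x y : R[i]) :
    subunit_gram u -> (forall i k, unimodular (z i k)) ->
    unimodular x -> unimodular y -> s != [::] -> uniq (i :: s) ->
    Re (path_phase z i s * u i (last i s))
      <= Re (path_phase z i s * (x * y^*%C)) ->
  exists e, [/\ forall k, unimodular (e k), e i = x, e (last i s) = y
              & path (dominates z u e) i s].
Proof.
move=> gu uz + uy; case: s => // j s + _.
elim: s i j x => [|k s IH] i j x ux.
  rewrite /= inE andbT => ij; rewrite mulr1 => h.
  exists (fun k => if k == i then x else y).
  rewrite /dominates eqxx eq_sym (negPf ij) andbT; split=> // k.
  by case: ifP.
move=> /andP[ninot js].
rewrite [path_phase _ _ _]/= -/(path_phase z j (k :: s)) => h.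
have [|t [ut h1 h2]] := insert_phase j gu (uz i j) _ ux uy h.
  exact: path_phase_unimodular.
have [e [ue ej el ep]] := IH j k t ut js h2.
have ne l : l \in j :: k :: s -> (l == i) = false.
  by move=> hl; apply/negbTE; apply: contraNneq ninot => <-.
(* By uniqueness [i] does not occur in the tail, so setting its phase to [x] leaves the tail
   dominated. *)
exists (fun l => if l == i then x else e l); split.
- by move=> l; case: ifP.
- by rewrite eqxx.
- by rewrite /= ne ?el // in_cons mem_last orbT.
- rewrite [path _ _ _]/= -/(path _ j (k :: s)); apply/andP; split.
    by rewrite /dominates eqxx ne ?mem_head // ej.
  rewrite -(@eq_in_path _ (mem (j :: k :: s)) (dominates z u e)) //.
    by move=> l m hl hm; rewrite /dominates !ne.
  exact/allP.
Qed.

(** * Quarter turns and phases around a cycle with a chord *)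

Definition quarter_turns (R : realType) : seq R[i] :=
  [:: 1; -1; 'i%C; - 'i%C].

(** This form makes closure under products and conjugation immediate. *)
Lemma quarter_turnsP (R : realType) (z : R[i]) :
  (z \in quarter_turns R) = (z ^+ 4 == 1).
Proof.
rewrite !inE -[z == -1]addr_eq0 -[z == - 'i%C]addr_eq0 -[z == 1]subr_eq0.
rewrite -[z == 'i%C]subr_eq0 -!mulf_eq0 -[RHS]subr_eq0; congr (_ == 0).
have -> : (z - 1) * ((z + 1) * ((z - 'i%C) * (z + 'i%C)))
  = (z ^+ 2 - 1) * (z ^+ 2 - 'i%C ^+ 2) by ring.
by rewrite sqr_i; ring.
Qed.

Lemma quarter_turns_uniq (R : realType) : uniq (quarter_turns R).
Proof.
by rewrite /= !inE !eq_complex /= !(oppr0, eqr_opp, oner_eq0, oppr_eq0,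
  eqxx, andbF, andbT, orbF) ?[0 == _]eq_sym ?oppr_eq0 ?oner_eq0 //
  -?addr_eq0 -?mulr2n ?pnatr_eq0 //.
Qed.

(** Slide [w] in the direction opposite to the conjugate of [m] until it meets the unit circle. The
    real part for [- m] does not decrease, the two perpendicular quarter turns see no change, and
    only [m] can lose. *)
Lemma avoid_quarter_turn (R : realType) (m w : R[i]) :
    m \in quarter_turns R -> Re (w^*%C * w) <= 1 ->
  exists2 t, unimodular t & forall z, z \in quarter_turns R -> z != m ->
    Re (z * w) <= Re (z * t).
Proof.
case: w => x y mq; simpc => /= h; rewrite -!expr2 in h.
have [x1 y1] : 0 <= 1 - x ^+ 2 /\ 0 <= 1 - y ^+ 2 by split; nra.
set s := Num.sqrt (1 - x ^+ 2); set t := Num.sqrt (1 - y ^+ 2).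
have [sE tE] : s ^+ 2 = 1 - x ^+ 2 /\ t ^+ 2 = 1 - y ^+ 2 by rewrite !sqr_sqrtr.
have [s0 t0] : 0 <= s /\ 0 <= t by rewrite !sqrtr_ge0.
have [/andP[x_lb x_ub] /andP[y_lb y_ub]] : (- t <= x <= t) /\ (- s <= y <= s).
  by split; apply/andP; split; nra.
suff [v [vu hv]] : exists v : R[i], unimodular v /\
    forall z, z \in filter (predC1 m) (quarter_turns R) ->
      Re (z * (x +i* y)%C) <= Re (z * v).
  by exists v => // z zq zm; apply: hv; rewrite mem_filter /= zm.
move: mq; rewrite !inE => /or4P[] /eqP ->.
- exists (- t +i* y)%C; split; first by apply/unimodularP; nra.
  move=> z; rewrite mem_filter !inE /= => /andP[/negPf -> /=].
  by case/or3P => /eqP ->; simpc => /=; rewrite ?lerN2 // lerNl.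
- exists (t +i* y)%C; split; first by apply/unimodularP; nra.
  move=> z; rewrite mem_filter !inE /= => /andP[/negPf -> /=].
  by case/or3P => /eqP ->; simpc => /=; rewrite ?lerN2 // lerNl.
- exists (x +i* s)%C; split; first by apply/unimodularP; nra.
  move=> z; rewrite mem_filter !inE /= => /andP[/negPf -> /=].
  by case/or3P => /eqP ->; simpc => /=; rewrite ?lerN2 // lerNl.
- exists (x +i* - s)%C; split; first by apply/unimodularP; nra.
  move=> z; rewrite mem_filter !inE /= => /andP[/negPf -> /=].
  by rewrite orbF; case/or3P => /eqP ->; simpc => /=; rewrite ?lerN2 // lerNl.
Qed.

Lemma three_quarter_turns (R : realType) (w z0 z1 z2 : R[i]) :
    Re (w^*%C * w) <= 1 -> all (mem (quarter_turns R)) [:: z0; z1; z2] ->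
  exists2 t, unimodular t &
    forall z, z \in [:: z0; z1; z2] -> Re (z * w) <= Re (z * t).
Proof.
move=> w1 /allP qz.
have [m mq mz] : exists2 m, m \in quarter_turns R & m \notin [:: z0; z1; z2].
  apply: contrapT => H.
  suff /(uniq_leq_size (quarter_turns_uniq R)) :
    {subset quarter_turns R <= [:: z0; z1; z2]} by [].
  by move=> m mq; apply: contrapT => /negP mz; apply: H; exists m.
have [t ut ht] := avoid_quarter_turn mq w1.
exists t => // z hz; apply: ht; first exact: qz.
by apply: contraNneq mz => <-.
Qed.

Lemma path_phase_quarter (R : realType) (n : nat)
    (z : 'I_n -> 'I_n -> R[i]) i s :
  (forall i k, z i k \in quarter_turns R) ->
  path_phase z i s \in quarter_turns R.
Proof.
move=> qz; elim: s i => [|k s IH] i /=; first by rewrite inE eqxx.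
move: (qz i k) (IH k); rewrite !quarter_turnsP exprMn => /eqP -> /eqP ->.
by rewrite mulr1.
Qed.

Lemma quarter_turn_unimodular (R : realType) (z : R[i]) :
  z \in quarter_turns R -> unimodular z.
Proof.
have uN (t : R[i]) : unimodular t -> unimodular (- t).
  by rewrite /unimodular rmorphN mulrNN.
have ui : unimodular ('i%C : R[i]) by apply/unimodularP; ring.
have u1 := unimodular1 R.
by rewrite !inE => /or4P[] /eqP -> //; exact: uN.
Qed.

Lemma cycle_dominates (R : realType) (n : nat) (z u : 'I_n -> 'I_n -> R[i])
    (s : seq 'I_n) a b :
    subunit_gram u -> (forall i k, u k i = (u i k)^*%C) ->
    (forall i k, z i k \in quarter_turns R) ->
    uniq s -> a \in s -> b \in s -> a != b ->
  exists e, [/\ forall k, unimodular (e k), dominates z u e a b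
              & forall i, i \in s -> dominates z u e i (next s i)].
Proof.
move=> gu hu qz us as_ bs ab.
have uz i k : unimodular (z i k) by exact: quarter_turn_unimodular.
have [r s' sE] := rot_to as_.
have : b \in a :: s' by rewrite -sE mem_rot.
rewrite inE eq_sym (negPf ab) /= => bs'.
case/splitPr: bs' sE => p1 p2 sE.
have : uniq (a :: p1 ++ b :: p2) by rewrite -sE rot_uniq.
rewrite -cat_cons cat_uniq => /and3P[u1 hp u2].
have hp' k : k \in b :: p2 -> k \notin a :: p1 by move/(hasPn hp).
set w := u a b.
have w1 : Re (w^*%C * w) <= 1.
  (* At these coefficients the form equals 1 - |w|^2. *)
  have := gu a b b w (-1) 0.
  by rewrite /w; case: (u a b) => x y; simpc => /=; nra.
set q1 := rcons p1 b; set q2 := rcons p2 a.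
have Q1 := path_phase_quarter a q1 qz; have Q2 := path_phase_quarter b q2 qz.
have Q2c : (path_phase z b q2)^*%C \in quarter_turns R.
  by move: Q2; rewrite !quarter_turnsP -rmorphXn => /eqP ->; rewrite rmorph1.
(* The phase at [b] is normalised to 1, so the phase [t] at [a] is the only unknown. The second path
   runs from [b] back to [a], hence its conjugate multiplier. *)
have [|t ut ht] := @three_quarter_turns _ w (z a b) (path_phase z a q1)
    (path_phase z b q2)^*%C w1.
  by rewrite /= qz Q1 Q2c.
have ht' y : y \in [:: z a b; path_phase z a q1; (path_phase z b q2)^*%C] ->
    Re (y * w) <= Re (y * (t * 1^*%C)) by move/ht; rewrite rmorph1 mulr1.
have Re_conj (y v : R[i]) : Re (y * v^*%C) = Re (y^*%C * v).
  by case: y v => [? ?] [? ?]; simpc.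
have [|||e1 [ue1 e1a e1b d1]] :=
    @path_dominates _ _ z u a q1 t 1 gu uz ut (unimodular1 R).
- by rewrite -size_eq0 size_rcons.
- have : b \notin a :: p1 by rewrite hp' ?mem_head.
  rewrite cons_uniq mem_rcons rcons_uniq !inE !negb_or ab.
  by rewrite cons_uniq in u1; case/andP: u1 => -> -> /andP[_ ->].
- by rewrite last_rcons; apply: ht'; rewrite !inE eqxx orbT.
have [|||e2 [ue2 e2b e2a d2]] :=
    @path_dominates _ _ z u b q2 1 t gu uz (unimodular1 R) ut.
- by rewrite -size_eq0 size_rcons.
- rewrite cons_uniq mem_rcons rcons_uniq inE negb_or eq_sym ab.
  rewrite cons_uniq in u2; case/andP: u2 => -> ->; rewrite !andbT.
  by apply/negP => ap2; have := hp' a; rewrite !inE ap2 orbT eqxx => /(_ isT).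
- rewrite last_rcons hu mul1r !Re_conj.
  by apply: ht; rewrite !inE eqxx !orbT.
rewrite !last_rcons in e1b e2a.
(* The two assignments agree at their shared ends, [t] at [a] and 1 at [b], so both paths stay
   dominated after gluing. *)
set e := fun k => if k \in b :: p2 then e2 k else e1 k.
have ea : e a = t.
  by rewrite /e ifN //; apply/negP => /hp'; rewrite mem_head.
have ee1 : {in a :: q1, e =1 e1}.
  move=> k; rewrite /e /q1 -rcons_cons mem_rcons inE => /orP[/eqP ->|kp].
    by rewrite mem_head e1b e2b.
  by case: ifP => // kp2; case/negP: (hp' _ kp2).
have ee2 : {in b :: q2, e =1 e2}.
  move=> k; rewrite /q2 -rcons_cons mem_rcons inE => /orP[/eqP ->|kp].
    by rewrite ea e2a.
  by rewrite /e kp.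
have eb : e b = 1 by rewrite ee2 ?mem_head.
exists e; split.
- by move=> k; rewrite /e; case: ifP.
- by rewrite /dominates ea eb; apply: ht'; rewrite mem_head.
move=> i si; rewrite -(next_rot r us).
apply: next_cycle; last by rewrite mem_rot.
rewrite sE /= rcons_cat rcons_cons -cat_rcons cat_path last_rcons.
apply/andP; split.
  rewrite -(@eq_in_path _ (mem (a :: q1)) (dominates z u e1)) //;
    last exact/allP.
  by move=> k l hk hl; rewrite /dominates !ee1.
rewrite -(@eq_in_path _ (mem (b :: q2)) (dominates z u e2)) //; last exact/allP.
by move=> k l hk hl; rewrite /dominates !ee2.
Qed.

(** * Convex hulls and matching prescribed entries *)

Lemma convex_setP (R : numDomainType) (E : lmodType R) (A : set E) :
  @convex_set R E A <-> forall x y (t : R), 0 <= t -> t <= 1 ->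
    A x -> A y -> A (t *: x + (1 - t) *: y).
Proof.
split=> [cA x y t t0 t1 Ax Ay|H x y l].
  by have := cA x y (Itv01 t0 t1) (mem_set Ax) (mem_set Ay); rewrite inE.
by rewrite !inE; exact: H.
Qed.

Lemma convex_convhull (R : realType) (E : lmodType R) (A : set E) :
  @convex_set R E (convhull A).
Proof.
apply/convex_setP => x y t t0 t1 hx hy B [cB AB].
by move/convex_setP: (cB); apply=> //; [exact: hx|exact: hy].
Qed.

(* Induction on E: the half-spaces F i0 k0 >= G i0 k0 and F i0 k0 <= G i0 k0 cut
   K into convex sets satisfying the hypothesis on the remaining entries, and
   the two matrices so obtained have a convex combination agreeing with G at
   (i0, k0) too. *)
Lemma convex_match_entries (R : realType) (m n : nat) (K : set 'M[R]_(m, n))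
    (G : 'M[R]_(m, n)) (E : seq ('I_m * 'I_n)) :
    @convex_set R 'M[R]_(m, n) K ->
    (forall sg : 'I_m -> 'I_n -> bool, exists2 F : 'M[R]_(m, n), K F &
      forall i k, (i, k) \in E ->
        if sg i k then G i k <= F i k else F i k <= G i k) ->
  exists2 F : 'M[R]_(m, n), K F & forall i k, (i, k) \in E -> F i k = G i k.
Proof.
elim: E K => [|[i0 k0] E IH] K /convex_setP cK H.
  by have [F KF _] := H (fun _ _ => true); exists F.
(* A repeated entry is dropped first: otherwise [sg'] below would overrule [sg] at an entry still in
   [E]. *)
have [inE0|ninE0] := boolP ((i0, k0) \in E).
  have [|F KF hF] := IH K ((convex_setP K).2 cK).
    move=> sg; have [F KF hF] := H sg; exists F => // i k ik.
    by apply: hF; rewrite inE ik orbT.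
  by exists F => // i k; rewrite inE => /orP[/eqP[-> ->]|]; exact: hF.
have side (b : bool) : exists2 F : 'M[R]_(m, n),
    K F /\ (if b then G i0 k0 <= F i0 k0 else F i0 k0 <= G i0 k0) &
    forall i k, (i, k) \in E -> F i k = G i k.
  apply: (IH [set F | K F /\
    if b then G i0 k0 <= F i0 k0 else F i0 k0 <= G i0 k0]).
    apply/convex_setP => x y t t0 t1 [Kx hx] [Ky hy]; split; first exact: cK.
    by rewrite !mxE; case: b hx hy => ? ?; nra.
  move=> sg; pose sg' i k := if (i, k) == (i0, k0) then b else sg i k.
  have [F KF hF] := H sg'; exists F.
    by split=> //; have := hF i0 k0; rewrite /sg' mem_head eqxx; exact.
  move=> i k ik; have := hF i k; rewrite /sg' inE ik orbT.
  have /negPf -> : (i, k) != (i0, k0) by apply: contraNneq ninE0 => <-.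
  exact.
have [F1 [KF1 h1] e1] := side true; have [F2 [KF2 h2] e2] := side false.
have [t [t0 t1 ht]] : exists t : R, [/\ 0 <= t, t <= 1 &
    t * F1 i0 k0 + (1 - t) * F2 i0 k0 = G i0 k0].
  have [E12|E12] := eqVneq (F1 i0 k0) (F2 i0 k0).
    by exists 0; split=> //; rewrite mul0r subr0 mul1r add0r; lra.
  have d0 : 0 < F1 i0 k0 - F2 i0 k0.
    by rewrite subr_gt0 lt_neqAle eq_sym E12 (le_trans h2).
  exists ((G i0 k0 - F2 i0 k0) / (F1 i0 k0 - F2 i0 k0)); split.
  - by rewrite divr_ge0 ?subr_ge0 // ltW // -subr_gt0.
  - by rewrite ler_pdivrMr // mul1r lerD2r.
  - by field; rewrite gt_eqF.
exists (t *: F1 + (1 - t) *: F2); first exact: cK.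
move=> i k; rewrite !mxE inE => /orP[/eqP[-> ->] //|ik].
by rewrite e1 // e2 //; ring.
Qed.

(** * Lossless injections and the relaxed region *)

Lemma Re_sum (R : realType) (I : Type) (r : seq I) (P : pred I)
    (F : I -> R[i]) :
  Re (\sum_(i <- r | P i) F i) = \sum_(i <- r | P i) Re (F i).
Proof. by rewrite (big_morph (@complex.Re R) (@ReD R) (erefl _)). Qed.

Lemma re_diag_lossless (R : realType) (n : nat) (Y W : 'M[R[i]]_n) :
    (forall i k, Re (Y i k) = 0) ->
  re_diag (W *m Y ^t*) = \col_i \sum_k Im (W i k) * Im (Y i k).
Proof.
move=> Y0; apply/colP => i; rewrite !mxE Re_sum; apply: eq_bigr => k _.
rewrite !mxE; have := Y0 i k; case: (W i k) (Y i k) => [a b] [c d] /= ->.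
by rewrite mulr0 mulrN opprK add0r.
Qed.

Lemma possemidef_zero_diag (R : realType) (n : nat) (W : 'M[R[i]]_n) i k :
  possemidef W -> Re (W i i) <= 0 -> W i k = 0.
Proof.
move=> psdW Wi; set w := W i k; set m := Re (w^*%C * w).
have Wk : 0 <= Re (W k k).
  have := possemidef_quad3 k k k 1 0 0 psdW; rewrite lecE => /andP[_].
  by rewrite !(mulr0, mul0r, addr0, conjc0, conjc1, mul1r).
(* With a and c the real parts of [W i i] and [W k k], the form at this vector is (c + 1)^2 m a -
   m^2 (c + 2), which is negative for a <= 0 unless m = 0. *)
have := possemidef_quad3 i k k ((Re (W k k) + 1)%:C%C * w) (- m)%:C%C 0 psdW.
rewrite lecE => /andP[_].
rewrite !(mulr0, mul0r, addr0, conjc0) (hermsymmx_entry i k psdW.1).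
move: Wi Wk; rewrite /m /w.
case: (W i i) (W k k) (W i k) => [a b] [c d] [x y] /= a0 c0 h.
set q := x ^+ 2 + y ^+ 2.
have q0 : 0 <= q by rewrite addr_ge0 ?sqr_ge0.
have : q ^+ 2 * (c + 2) <= (c + 1) ^+ 2 * q * a.
  rewrite -subr_ge0; apply: le_trans h _.
  by rewrite le_eqVlt; apply/orP; left; apply/eqP; rewrite /q; ring.
move=> {}h; have : q ^+ 2 * (c + 2) <= 0.
  by apply: le_trans h _; rewrite mulr_ge0_le0 // mulr_ge0 ?sqr_ge0.
rewrite pmulr_lle0; last lra.
rewrite real_exprn_even_le0 ?num_real //= => /eqP /eqP.
rewrite paddr_eq0 ?sqr_ge0 // !sqrf_eq0 => /andP[/eqP -> /eqP ->].
by [].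
Qed.

Lemma injection_sub_relaxed (R : realType) (n : nat) (Y : 'M[R[i]]_n)
    (Vmin Vmax : 'I_n -> R) :
    (forall i, 0 <= Vmin i <= Vmax i) ->
  injection_region Y Vmin Vmax `<=` relaxed_injection_region Y Vmin Vmax.
Proof.
move=> HV p [v [-> hv]]; exists (v *m v ^t*).
have herm : v *m v ^t* \is hermsymmx.
  apply/is_hermitianmxP; rewrite scale1r; apply/matrixP => i k.
  rewrite !mxE !big_ord1 !mxE; case: (v i 0) (v k 0) => [a b] [c d].
  by apply/eqP; rewrite eq_complex /=; apply/andP; split; apply/eqP; ring.
split=> //.
  move=> i; rewrite mxE big_ord1 !mxE -normCK.
  have /andP[V0 VV] := HV i; have /andP[v1 v2] := hv i.
  rewrite !rmorphXn /= !ler_pXn2r ?nnegrE ?normr_ge0 ?ler0c ?v1 ?v2 //.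
  exact: le_trans VV.
split=> // x; rewrite mulmxA -mulmxA.
have vx : (v ^t* *m x) 0 0 = ((x ^t* *m v) 0 0)^*%C.
  rewrite !mxE rmorph_sum; apply: eq_bigr => k _; rewrite !mxE.
  case: (v k 0) (x k 0) => [a b] [c d].
  by apply/eqP; rewrite eq_complex /=; apply/andP; split; apply/eqP; ring.
by rewrite mxE big_ord1 vx mulcJ_ge0.
Qed.

Lemma convex_relaxed (R : realType) (n : nat) (Y : 'M[R[i]]_n)
    (Vmin Vmax : 'I_n -> R) :
  @convex_set R 'cV[R]_n (relaxed_injection_region Y Vmin Vmax).
Proof.
apply/convex_setP => x y t t0 t1 [W1 [h1 -> d1 [_ p1]]] [W2 [h2 -> d2 [_ p2]]].
exists (t%:C%C *: W1 + (1 - t)%:C%C *: W2).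
have t1' : 0 <= 1 - t by rewrite subr_ge0.
have herm : t%:C%C *: W1 + (1 - t)%:C%C *: W2 \is hermsymmx.
  apply/is_hermitianmxP; rewrite scale1r; apply/matrixP => i k; rewrite !mxE.
  rewrite (hermsymmx_entry k i h1) (hermsymmx_entry k i h2).
  by case: (W1 k i) (W2 k i) => [? ?] [? ?]; simpc.
split; first exact: herm.
- have lin (A B : 'M[R[i]]_n) : re_diag (t%:C%C *: A + (1 - t)%:C%C *: B)
      = t *: re_diag A + (1 - t) *: re_diag B.
    by apply/colP => i; rewrite !mxE ReD !Re_realM.
  by rewrite mulmxDl -!scalemxAl lin.
- move=> i; move: (d1 i) (d2 i); rewrite !mxE !lecE.
  case: (W1 i i) (W2 i i) => [a b] [c d] /=.
  move=> /andP[/andP[/eqP -> l1] /andP[_ l2]].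
  move=> /andP[/andP[/eqP -> l3] /andP[_ l4]].
  by rewrite !(mulr0, mul0r, addr0, subr0) eqxx /=; apply/andP; split; nra.
- split; first exact: herm.
  move=> v; rewrite mulmxDr mulmxDl -!scalemxAr -!scalemxAl.
  by rewrite mxE addr_ge0 // mxE mulr_ge0 ?ler0c.
Qed.

(** * Voltages for a prescribed sign pattern *)

(** Undoes the normalisation. If [r i] or [r k] is 0, its inverse is 0 as well, but then [W i k]
    vanishes by [possemidef_zero_diag]. *)
Lemma entry_polar (R : realType) (n : nat) (W : 'M[R[i]]_n) i k :
    possemidef W ->
  let r j := Num.sqrt (Re (W j j)) in
  W i k = (r i * r k)%:C%C * (W i k * ((r i)^-1 * (r k)^-1)%:C%C).
Proof.
move=> psdW r.
have [ri|ri] := eqVneq (r i) 0.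
  rewrite possemidef_zero_diag ?mul0r ?mulr0 //.
  by move/eqP: ri; rewrite sqrtr_eq0.
have [rk|rk] := eqVneq (r k) 0.
  rewrite (hermsymmx_entry k i psdW.1).
  rewrite possemidef_zero_diag ?conjc0 ?mul0r ?mulr0 //.
  by move/eqP: rk; rewrite sqrtr_eq0.
by rewrite mulrCA -rmorphM /= mulrACA !divff // mulr1 mulr1.
Qed.

Lemma unimodular_norm (R : realType) (z : R[i]) : unimodular z -> `|z| = 1.
Proof.
by case: z => x y /unimodularP h; rewrite normc_def /= h sqrtr1.
Qed.

Lemma dominating_injection (R : realType) (n : nat) (W : 'M[R[i]]_n)
    (Vmin Vmax : 'I_n -> R) (s : seq 'I_n) a b (sg : 'I_n -> 'I_n -> bool) :
    (forall i, 0 <= Vmin i <= Vmax i) -> possemidef W ->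
    (forall i, (Vmin i ^+ 2)%:C%C <= W i i <= (Vmax i ^+ 2)%:C%C) ->
    uniq s -> a \in s -> b \in s -> a != b ->
  exists2 v : 'cV[R[i]]_n,
    forall i, (Vmin i)%:C%C <= `|v i 0| <= (Vmax i)%:C%C &
    forall i k, (i, k) \in (a, b) :: [seq (i, next s i) | i <- s] ->
      if sg i k then Im (W i k) <= Im ((v *m v ^t*) i k)
      else Im ((v *m v ^t*) i k) <= Im (W i k).
Proof.
move=> HV psdW dW us sa sb ab.
pose r j := Num.sqrt (Re (W j j)).
pose u i k := W i k * ((r i)^-1 * (r k)^-1)%:C%C.
(* Re (- 'i * x) = Im x, so these multipliers turn domination into a lower or an upper bound on
   imaginary parts. *)
pose z i k : R[i] := if sg i k then - 'i%C else 'i%C.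
have qz i k : z i k \in quarter_turns R.
  by rewrite /z !inE; case: ifP; rewrite eqxx ?orbT.
have hu i k : u k i = (u i k)^*%C.
  rewrite /u (hermsymmx_entry i k psdW.1) [(r k)^-1 * _]mulrC.
  by rewrite ![_ * _%:C%C]mulrC conjc_realM.
have [e [ue dab dnext]] :=
  cycle_dominates (normalized_gram psdW) hu qz us sa sb ab.
(* Restores the magnitudes: |v i|^2 is the diagonal entry [W i i]. *)
pose v : 'cV[R[i]]_n := \col_i ((r i)%:C%C * e i).
exists v.
  move=> i; rewrite mxE normrM (unimodular_norm (ue i)) mulr1.
  rewrite ger0_norm ?ler0c ?sqrtr_ge0 // !lecR.
  have /andP[V0 VV] := HV i; have := dW i.
  rewrite /r !lecE /= => /andP[/andP[_ l1] /andP[_ l2]].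
  rewrite -[Vmin i]ger0_norm // -[Vmax i]ger0_norm ?(le_trans V0) //.
  have W0 := le_trans (sqr_ge0 _) l1.
  by rewrite -!sqrtr_sqr !ler_sqrt ?sqr_ge0 // l1.
move=> i k ik.
have {ik dab dnext} dom : dominates z u e i k.
  move: ik; rewrite inE => /orP[/eqP[-> ->] //|/mapP[j js [-> ->]]].
  exact: dnext.
have -> : (v *m v ^t*) i k = (r i * r k)%:C%C * (e i * (e k)^*%C).
  rewrite !mxE big_ord1 !mxE; case: (e i) (e k) => [c1 d1] [c2 d2].
  by apply/eqP; rewrite eq_complex /=; apply/andP; split; apply/eqP; ring.
rewrite (entry_polar i k psdW) !Im_realM -/(r _) -/(r _) -/(u i k).
have rr : 0 <= r i * r k by rewrite mulr_ge0 ?sqrtr_ge0.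
move: dom; rewrite /dominates /z.
case: (u i k) (e i * _) => [c1 d1] [c2 d2].
by case: ifP => _; simpc => /= h; apply: ler_wpM2l; rewrite // -lerN2.
Qed.

(** * The line set, and equality of the two regions *)

Lemma cycle_or_chord_edges (R : realType) (n : nat) (N : network R n) :
    lossless_cycle N \/ lossless_cycle_with_chord N ->
  lossless N /\ exists s a b,
    [/\ uniq s, forall i, i \in s, a != b &
        forall i k, line N i k ->
          let E := (a, b) :: [seq (j, next s j) | j <- s] in
          (i, k) \in E \/ (k, i) \in E].
Proof.
have next_in (s : seq 'I_n) i k : (forall j, j \in s) -> next s i == k ->
    (i, k) \in [seq (j, next s j) | j <- s].
  by move=> sP /eqP <-; apply/mapP; exists i.
case=> [[lN [s [n2 us sP] NE]]|[lN [s [a [b [[n2 us sP] ab _ NE]]]]]];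
  split=> //.
  case: n N lN s n2 us sP NE next_in => [|[|n]] // N _ s _ us sP NE next_in.
  (* A plain cycle is treated with an arbitrary pair of distinct buses in place of the chord. *)
  exists s, ord0, ord_max; split=> // i k; rewrite NE /= !inE.
  by case/orP => h; [left|right]; rewrite (next_in _ _ _ sP h) orbT.
exists s, a, b; split=> // i k; rewrite NE /= !inE.
case/or3P => [/orP[] h||].
- by left; rewrite (next_in _ _ _ sP h) orbT.
- by right; rewrite (next_in _ _ _ sP h) orbT.
- by case/andP => /eqP -> /eqP ->; left; rewrite eqxx.
- by case/andP => /eqP -> /eqP ->; right; rewrite eqxx.
Qed.

Theorem theorem5 (R : realType) (n : nat) (N : network R n)
    (Vmin Vmax : 'I_n -> R)
    (HV : forall i : 'I_n, 0 <= Vmin i <= Vmax i)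
    (HN : lossless_cycle N \/ lossless_cycle_with_chord N) :
  convhull (injection_region (bus_admittance N) Vmin Vmax)
  = relaxed_injection_region (bus_admittance N) Vmin Vmax.
Proof.
apply/seteqP; split.
  apply: smallest_sub; first exact: convex_relaxed.
  exact: injection_sub_relaxed.
have [lN [s [a [b [us sP ab NE]]]]] := cycle_or_chord_edges HN.
set Y := bus_admittance N in lN *.
move=> p [W [_ -> dW psdW]]; rewrite re_diag_lossless //.
pose bal (F : 'M[R]_n) : 'cV[R]_n := \col_i \sum_k F i k * Im (Y i k).
have bal_lin t (F G : 'M[R]_n) : bal (t *: F + (1 - t) *: G)
    = t *: bal F + (1 - t) *: bal G.
  apply/colP => i; rewrite !mxE !mulr_sumr -big_split /=.
  by apply: eq_bigr => k _; rewrite !mxE; ring.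
pose ImW : 'M[R]_n := \matrix_(i, k) Im (W i k).
(* Imaginary parts are matched instead of injections. Antisymmetry is built into the convex set
   because each line is listed in one orientation only, and because it makes the diagonal vanish. *)
have [||F [KF1 KF2] FW] := @convex_match_entries R n n [set F : 'M[R]_n |
    F^T = - F /\ convhull (injection_region Y Vmin Vmax) (bal F)]
    ImW ((a, b) :: [seq (i, next s i) | i <- s]).
- apply/convex_setP => F G t t0 t1 [F1 F2] [G1 G2]; split.
    by rewrite linearD !linearZ /= F1 G1 !scalerN opprD.
  have /convex_setP cvx :=
    @convex_convhull R 'cV[R]_n (injection_region Y Vmin Vmax).
  by rewrite /= bal_lin; exact: cvx.
- move=> sg.
  have [v hv hd] := dominating_injection sg HV psdW dW us (sP a) (sP b) ab.
  exists (\matrix_(i, k) Im ((v *m v ^t*) i k)); last first.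
    by move=> i k ik; rewrite !mxE -?mxE; have := hd i k ik; rewrite !mxE.
  split.
    apply/matrixP => i k; rewrite !mxE !big_ord1 !mxE.
    by case: (v i 0) (v k 0) => [c1 d1] [c2 d2] /=; ring.
  apply: sub_gen_smallest; exists v; split=> //.
  rewrite re_diag_lossless //; apply/colP => i; rewrite !mxE.
  by apply: eq_bigr => k _; rewrite mxE.
have anti i k : F k i = - F i k by have /matrixP/(_ i k) := KF1; rewrite !mxE.
have antiW i k : Im (W k i) = - Im (W i k).
  by rewrite (hermsymmx_entry i k psdW.1); case: (W i k).
suff -> : \col_i \sum_k Im (W i k) * Im (Y i k) = bal F by [].
apply/colP => i; rewrite !mxE; apply: eq_bigr => k _.
(* Diagonal terms vanish by antisymmetry, pairs off the graph because [Y i k] is 0, and on lines [F]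
   agrees with the imaginary part of [W]. *)
have [<-|ik] := eqVneq i k.
  have F0 := anti i i; have W0 := antiW i i.
  have -> : F i i = 0 by lra.
  by have -> : Im (W i i) = 0 by lra.
have [/NE|nN] := boolP (line N i k); last first.
  by rewrite /Y /bus_admittance mxE (negPf ik) (negPf nN) !mulr0.
case=> /FW; rewrite mxE => h; first by rewrite h.
by rewrite anti h antiW.
Qed.
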